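(* Let $X$ be an infinite set and let $(X,\tau)$ be a Hausdorff space. If $(X,\tau)$ is locally compact and second countable, then $(X,\tau^{\star})$ is second countable, where $\tau^{\star}$ is the compact complement topology of $(X,\tau)$.
   Context: The result is a theorem of $\mathbf{ZF}$ (no axiom of choice). For a Hausdorff space $(X,\tau)$ with $X$ infinite, the compact complement topology of $(X,\tau)$ is $\tau^{\star}=\{\emptyset\}\cup\{X\setminus M : M \text{ is compact in } (X,\tau)\}$, which is a topology on $X$. Compact means that every open cover has a finite subcover. *)

(* Defs.v *)
From Stdlib Require Import Ensembles Finite_sets Classical.
From Stdlib Require Import FunctionalExtensionality PropExtensionality.

(* The topologicalType of MathComp-Analysis carries a choice operator on its
   points.  The theorem is one of ZF, so topologies are plain families of
   Ensembles here, and no definition below uses a choice operator or an axiom. *)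

Arguments In {U} _ _.
Arguments Included {U} _ _.
Arguments Empty_set {U}.
Arguments Full_set {U}.
Arguments Intersection {U} _ _.
Arguments Union {U} _ _.
Arguments Add {U} _ _.
Arguments Complement {U} _.
Arguments Disjoint {U} _ _.
Arguments Finite {U}.

Section Topology.

Context {X : Type}.

Implicit Types (tau : Ensemble (Ensemble X)) (U V M : Ensemble X).

Definition family_union (C : Ensemble (Ensemble X)) : Ensemble X :=
  fun x => exists U, In C U /\ In U x.

Record is_topology tau : Prop := {
  open_empty : In tau Empty_set;
  open_full : In tau Full_set;
  open_inter : forall U V, In tau U -> In tau V -> In tau (Intersection U V);
  open_union : forall C, Included C tau -> In tau (family_union C)
}.

Definition hausdorff tau : Prop :=
  forall x y : X, x <> y ->
    exists U V, In tau U /\ In tau V /\ In U x /\ In V y /\ Disjoint U V.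

Definition compact tau M : Prop :=
  forall C, Included C tau -> Included M (family_union C) ->
    exists D, Included D C /\ Finite D /\ Included M (family_union D).

Definition neighborhood tau (x : X) M : Prop :=
  exists U, In tau U /\ In U x /\ Included U M.

Definition locally_compact tau : Prop :=
  forall x : X, exists M, neighborhood tau x M /\ compact tau M.

Definition is_base tau (B : Ensemble (Ensemble X)) : Prop :=
  Included B tau /\
  forall U, In tau U -> exists C, Included C B /\ U = family_union C.

(* Finite families and the empty family are included: [f] may repeat values and
   take values outside [B].  An enumeration is used rather than an injection
   into [nat] because, without a description axiom, an injection in the sense
   of ZF need not be given by a Rocq function [Ensemble X -> nat]. *)
Definition countable_family (B : Ensemble (Ensemble X)) : Prop :=
  exists f : nat -> Ensemble X, forall U, In B U -> exists n, f n = U.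

Definition second_countable tau : Prop :=
  exists B, countable_family B /\ is_base tau B.

Definition compact_complement tau : Ensemble (Ensemble X) :=
  fun U => U = Empty_set \/ exists M, compact tau M /\ U = Complement M.

End Topology.

Definition infinite (X : Type) : Prop := ~ Finite (@Full_set X).

Section CompactComplementIsTopology.

Context {X : Type}.

Implicit Types (tau C D : Ensemble (Ensemble X)) (U V M N : Ensemble X).

Lemma ensemble_ext (T : Type) (A B : Ensemble T) :
  (forall x, In A x <-> In B x) -> A = B.
Proof.
intros H; apply functional_extensionality; intros x.
apply propositional_extensionality; exact (H x).
Qed.

Lemma finite_union (T : Type) (A B : Ensemble T) :
  Finite A -> Finite B -> Finite (Union A B).
Proof.
intros HA HB; induction HA as [|A HA IH a Ha].
- replace (Union Empty_set B) with B; [exact HB|].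
  apply ensemble_ext; intros x; split; [now right|].
  now intros [y []|y Hy].
- destruct (classic (In (Union A B) a)) as [Hin|Hnin].
  + replace (Union (Add A a) B) with (Union A B); [exact IH|].
    apply ensemble_ext; intros x; split.
    * intros [y Hy|y Hy]; [left; now left | now right].
    * intros [y [z Hz|z []]|y Hy]; [now left | exact Hin | now right].
  + replace (Union (Add A a) B) with (Add (Union A B) a);
      [now constructor|].
    apply ensemble_ext; intros x; split.
    * intros [y [z Hz|z Hz]|y []];
        [left; now left | now right | left; now right].
    * intros [y [z Hz|z []]|y Hy];
        [left; now left | now right | left; now right].
Qed.

Lemma finite_minus (T : Type) (A : Ensemble T) (a : T) :
  Finite A -> Finite (fun x => In A x /\ x <> a).
Proof.
intros HA; induction HA as [|A HA IH b Hb].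
- replace (fun x : T => In Empty_set x /\ x <> a) with (@Empty_set T);
    [constructor|].
  apply ensemble_ext; intros x; split; [intros []|intros [[] _]].
- destruct (classic (b = a)) as [-> |Hba].
  + replace (fun x : T => In (Add A a) x /\ x <> a) with A; [exact HA|].
    apply ensemble_ext; intros x; split.
    * intros Hx; split; [now left | now intros ->].
    * intros [[y Hy|y []] Hne]; [exact Hy | now destruct Hne].
  + replace (fun x : T => In (Add A b) x /\ x <> a)
      with (Add (fun x => In A x /\ x <> a) b).
    * constructor; [exact IH | now intros [? _]].
    * apply ensemble_ext; intros x; split.
      -- intros [y [Hy Hne]|y []]; split; [now left|assumption|now right|auto].
      -- intros [[y Hy|y []] Hne]; [left; now split | now right].
Qed.

Lemma compact_empty tau : compact tau Empty_set.
Proof.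
intros C _ _; exists Empty_set; split; [intros ? []|split; [constructor|]].
intros ? [].
Qed.

Lemma compact_union tau M N :
  compact tau M -> compact tau N -> compact tau (Union M N).
Proof.
intros HM HN C HC Hcov.
destruct (HM C HC) as [D [HD [FD cD]]].
{ intros x Hx; apply Hcov; now left. }
destruct (HN C HC) as [E [HE [FE cE]]].
{ intros x Hx; apply Hcov; now right. }
exists (Union D E); split; [|split].
- intros U [V HV|V HV]; auto.
- now apply finite_union.
- intros x [y Hy|y Hy].
  + destruct (cD y Hy) as [U [HU Uy]]; exists U; split; [now left|auto].
  + destruct (cE y Hy) as [U [HU Uy]]; exists U; split; [now right|auto].
Qed.

Lemma compact_closed_inter tau M N :
  In tau (Complement N) -> compact tau M -> compact tau (Intersection M N).
Proof.
intros HN HM C HC Hcov.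
destruct (HM (fun U => In C U \/ U = Complement N)) as [D [HD [FD cD]]].
- intros U [HU| ->]; [now apply HC | exact HN].
- intros x Hx; destruct (classic (In N x)) as [Nx|Nx].
  + destruct (Hcov x) as [U [HU Ux]]; [now split|].
    exists U; split; [now left|exact Ux].
  + exists (Complement N); split; [now right|exact Nx].
- exists (fun U => In D U /\ U <> Complement N); split; [|split].
  + intros U [HU Hne]; destruct (HD U HU) as [|E]; [auto|now destruct Hne].
  + now apply finite_minus.
  + intros x [y My Ny]; destruct (cD y My) as [U [HU Uy]].
    exists U; split; [split; [exact HU|]|exact Uy].
    intros ->; exact (Uy Ny).
Qed.

Lemma finite_avoid tau (x : X) D :
  is_topology tau -> Finite D ->
  (forall V, In D V -> exists U, In tau U /\ In U x /\ Disjoint U V) ->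
  exists U, In tau U /\ In U x /\ Disjoint U (family_union D).
Proof.
intros Ht FD; induction FD as [|D FD IH V0 HV0]; intros H.
- exists Full_set; split; [apply Ht|split; [constructor|]].
  constructor; intros z [z' _ [V [[] _]]].
- destruct IH as [U [HU [Ux dU]]]; [intros V HV; apply H; now left|].
  destruct (H V0) as [W [HW [Wx dW]]]; [now right|].
  exists (Intersection U W); split; [now apply Ht|split; [now split|]].
  constructor; intros z [z' [z'' Uz Wz] [V [[V' HV|V' []] Vz]]].
  + destruct dU as [dU]; apply (dU z''); split; [exact Uz|].
    exists V'; now split.
  + destruct dW as [dW]; apply (dW z''); now split.
Qed.

Lemma compact_open_complement tau M :
  is_topology tau -> hausdorff tau -> compact tau M -> In tau (Complement M).
Proof.
intros Ht Hh HM.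
replace (Complement M)
  with (family_union (fun U => In tau U /\ Included U (Complement M))).
{ apply Ht; now intros U [HU _]. }
apply ensemble_ext; intros x; split.
{ intros [U [[_ HU] Ux]]; now apply HU. }
intros Mx.
destruct (HM (fun V => In tau V /\
    exists U, In tau U /\ In U x /\ Disjoint U V)) as [D [HD [FD cD]]].
- now intros V [HV _].
- intros y My; destruct (Hh x y) as [U [V [HU [HV [Ux [Vy d]]]]]].
  { intros ->; exact (Mx My). }
  exists V; split; [split; [exact HV|now exists U]|exact Vy].
- destruct (finite_avoid tau x D Ht FD) as [U [HU [Ux [d]]]].
  { intros V HV; now destruct (HD V HV). }
  exists U; split; [split; [exact HU|]|exact Ux].
  intros z Uz Mz; apply (d z); split; [exact Uz|now apply cD].
Qed.

Lemma compact_complement_is_topology tau :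
  is_topology tau -> hausdorff tau -> is_topology (compact_complement tau).
Proof.
intros Ht Hh; split.
- now left.
- right; exists Empty_set; split; [apply compact_empty|].
  apply ensemble_ext; intros x; split; [intros _ []|constructor].
- intros U V [-> |[M [HM ->]]].
  { intros _; left; apply ensemble_ext; intros x.
    split; [intros [? []]; contradiction|intros []]. }
  intros [-> |[N [HN ->]]].
  { left; apply ensemble_ext; intros x; split; [intros [? _ []]|intros []]. }
  right; exists (Union M N); split; [now apply compact_union|].
  apply ensemble_ext; intros x; split.
  + intros [y My Ny] H; destruct H; [now apply My|now apply Ny].
  + intros H; split; intros ?; apply H; [now left|now right].
- intros C HC.
  destruct (classic (exists M, compact tau M /\ In C (Complement M)))
    as [[M [HM CM]]|Hno].
  + right; exists (Intersection M (Complement (family_union C))); split.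
    * apply compact_closed_inter; [|exact HM].
      replace (Complement (Complement (family_union C)))
        with (family_union C).
      -- apply Ht; intros U HU; destruct (HC U HU) as [-> |[N [HN ->]]];
           [apply Ht|now apply compact_open_complement].
      -- apply ensemble_ext; intros x; split; [intros H K; now apply K|].
         intros H; now apply NNPP.
    * apply ensemble_ext; intros x; split.
      -- intros H K; destruct K as [y _ K]; exact (K H).
      -- intros H; apply NNPP; intros K; apply H; split; [|exact K].
         apply NNPP; intros Mx; apply K; exists (Complement M); now split.
  + left; apply ensemble_ext; intros x; split; [|intros []].
    intros [U [HU Ux]]; destruct (HC U HU) as [-> |[N [HN ->]]]; [exact Ux|].
    destruct Hno; now exists N.
Qed.

End CompactComplementIsTopology.

(* Main.v *)
(* Given a countable base enumerated by [f], code a finite set of indices by the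
   binary digits of [n].  The sets [exterior tau (f k1 \/ ... \/ f kr)] whose
   argument lies in a compact set form a countable base of the compact complement
   topology: if K is compact and x is not in K, each y in K has a basic
   neighbourhood that lies in a compact set and is disjoint from some
   neighbourhood of x; finitely many of these cover K, and x is exterior to their
   union.  Coding by digits keeps the enumeration explicit, hence choice-free. *)

Require Import Defs.
From Stdlib Require Import Ensembles.
From Stdlib Require Import Finite_sets Classical Arith.

Section Exterior.

Context {X : Type}.

Implicit Types (tau B D : Ensemble (Ensemble X)) (U V A K M : Ensemble X).

Definition exterior tau A : Ensemble X :=
  family_union (fun U => In tau U /\ Disjoint U A).

(** In a Hausdorff space this is relative compactness: the closure of [A] is compact. *)
Definition in_compact tau A : Prop :=
  exists M, compact tau M /\ Included A M.

Lemma exterior_open tau A : is_topology tau -> In tau (exterior tau A).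
Proof. intros Ht; apply Ht; now intros U [HU _]. Qed.

Lemma exterior_disjoint tau A x : In (exterior tau A) x -> ~ In A x.
Proof.
intros [U [[_ [d]] Ux]] Ax; apply (d x); now split.
Qed.

(** The complement of the exterior is the closure of [A]. It lies in [M], which is closed because
    the space is Hausdorff, so it is compact. *)
Lemma exterior_compact_complement tau A :
  is_topology tau -> hausdorff tau -> in_compact tau A ->
  In (compact_complement tau) (exterior tau A).
Proof.
intros Ht Hh [M [HM AM]]; right.
assert (E : Complement (Complement (exterior tau A)) = exterior tau A).
{ apply ensemble_ext; intros x; split; [apply NNPP|intros H K; exact (K H)]. }
exists (Intersection M (Complement (exterior tau A))); split.
- apply compact_closed_inter; [|exact HM].
  rewrite E; now apply exterior_open.
- apply ensemble_ext; intros x; split.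
  + intros H I; destruct I as [y _ K]; exact (K H).
  + intros H; apply NNPP; intros Hx; apply H; split; [|exact Hx].
    apply NNPP; intros Mx; apply Hx.
    exists (Complement M); split; [split|exact Mx].
    * now apply compact_open_complement.
    * constructor; intros z [z' Mz Az]; exact (Mz (AM _ Az)).
Qed.

Lemma finite_union_in_compact tau D :
  Finite D -> (forall U, In D U -> in_compact tau U) ->
  in_compact tau (family_union D).
Proof.
intros FD; induction FD as [|D FD IH U0 HU0]; intros H.
- exists Empty_set; split; [apply compact_empty|intros x [U [[] _]]].
- destruct IH as [M [HM DM]]; [intros U HU; apply H; now left|].
  destruct (H U0) as [N [HN UN]]; [now right|].
  exists (Union M N); split; [now apply compact_union|].
  intros x [U [[U' HU|U' []] Ux]].
  + left; apply DM; now exists U'.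
  + right; now apply UN.
Qed.

Definition digit_union (f : nat -> Ensemble X) (n : nat) : Ensemble X :=
  fun x => exists k, Nat.testbit n k = true /\ In (f k) x.

Lemma finite_union_digits (f : nat -> Ensemble X) D :
  Finite D -> (forall U, In D U -> exists n, f n = U) ->
  exists n, digit_union f n = family_union D.
Proof.
intros FD; induction FD as [|D FD IH U0 HU0]; intros H.
- exists 0; apply ensemble_ext; intros x; split.
  + intros [k [Hk _]]; now rewrite Nat.bits_0 in Hk.
  + now intros [U [[] _]].
- destruct IH as [n Hn]; [intros U HU; apply H; now left|].
  destruct (H U0) as [m Hm]; [now right|].
  (* Setting bit [m] adjoins [f m] to the union. If the bit is already set, nothing changes, so
     repeated values of [f] do no harm. *)
  exists (Nat.setbit n m); apply ensemble_ext; intros x; split.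
  + intros [k [Hk kx]]; apply Nat.setbit_iff in Hk; destruct Hk as [<- |Hk].
    * exists U0; split; [now right|now rewrite <- Hm].
    * assert (Hx : In (digit_union f n) x) by now exists k.
      rewrite Hn in Hx; destruct Hx as [U [HU Ux]].
      exists U; split; [now left|exact Ux].
  + intros [U [[U' HU|U' []] Ux]].
    * assert (Hx : In (family_union D) x) by now exists U'.
      rewrite <- Hn in Hx; destruct Hx as [k [Hk kx]].
      exists k; split; [apply Nat.setbit_iff; now right|exact kx].
    * exists m; split; [apply Nat.setbit_iff; now left|now rewrite Hm].
Qed.

Lemma base_refine tau B U x :
  is_base tau B -> In tau U -> In U x ->
  exists V, In B V /\ In V x /\ Included V U.
Proof.
intros [_ HB] HU Ux; destruct (HB U HU) as [C [CB ->]].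
destruct Ux as [V [CV Vx]]; exists V; split; [auto|split; [exact Vx|]].
intros z Vz; now exists V.
Qed.

Lemma compact_cover_exterior tau B K x :
  is_topology tau -> hausdorff tau -> locally_compact tau -> is_base tau B ->
  compact tau K -> ~ In K x ->
  exists D, Included D B /\ Finite D /\ Included K (family_union D) /\
    in_compact tau (family_union D) /\ In (exterior tau (family_union D)) x.
Proof.
intros Ht Hh Hl HB HK Kx.
destruct (HK (fun V => In B V /\ in_compact tau V /\
    exists U, In tau U /\ In U x /\ Disjoint U V)) as [D [HD [FD cD]]].
- intros V [BV _]; now apply HB.
- intros y Ky; destruct (Hh x y) as [U [V [HU [HV [Ux [Vy [d]]]]]]].
  { intros ->; exact (Kx Ky). }
  destruct (Hl y) as [M [[W [HW [Wy WM]]] HM]].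
  (* [V] keeps the basic set away from [x]; [W] keeps it inside the compact neighbourhood [M] of
     [y]. *)
  destruct (base_refine tau B (Intersection V W) y HB)
    as [b [Bb [yb bVW]]]; [now apply Ht|now split|].
  exists b; split; [|exact yb].
  split; [exact Bb|split].
  + exists M; split; [exact HM|].
    intros z bz; destruct (bVW z bz) as [z' _ Wz]; now apply WM.
  + exists U; split; [exact HU|split; [exact Ux|]].
    constructor; intros z [z' Uz bz]; apply (d z'); split; [exact Uz|].
    now destruct (bVW z' bz).
- exists D; split; [intros V HV; now apply HD|].
  split; [exact FD|split; [exact cD|split]].
  + apply finite_union_in_compact; [exact FD|intros V HV; now apply HD].
  (* Finiteness of [D] enters here: the neighbourhoods of [x] that miss its members are
     intersected. *)
  + destruct (finite_avoid tau x D Ht FD) as [U [HU [Ux d]]].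
    { intros V HV; now apply HD. }
    exists U; split; [now split|exact Ux].
Qed.

End Exterior.

Theorem theorem2p12 (X : Type) (tau : Ensemble (Ensemble X))
  (X_infinite : infinite X)
  (tau_topology : is_topology tau)
  (tau_hausdorff : hausdorff tau)
  (tau_locally_compact : locally_compact tau)
  (tau_second_countable : second_countable tau) :
  second_countable (compact_complement tau).
Proof.
destruct tau_second_countable as [B [[f Hf] HB]].
exists (fun W => exists n, in_compact tau (digit_union f n) /\
                           exterior tau (digit_union f n) = W).
split; [|split].
(* All [n] are enumerated, also those whose union lies in no compact set; values outside the family
   are allowed. *)
- exists (fun n => exterior tau (digit_union f n)).
  intros W [n [_ E]]; now exists n.
- intros W [n [Hn <-]]; now apply exterior_compact_complement.
- intros U [-> |[K [HK ->]]].
  + exists Empty_set; split; [intros ? []|].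
    apply ensemble_ext; intros x; split; [intros []|intros [U [[] _]]].
  (* Taking every base member inside the open set avoids choosing one for each point. *)
  + exists (fun W => (exists n, in_compact tau (digit_union f n) /\
                        exterior tau (digit_union f n) = W) /\
                     Included W (Complement K)).
    split; [now intros W [HW _]|].
    apply ensemble_ext; intros x; split; [|intros [W [[_ HW] Wx]]; now apply HW].
    intros Kx.
    destruct (compact_cover_exterior tau B K x) as [D [DB [FD [KD [cD Dx]]]]];
      try assumption.
    destruct (finite_union_digits f D FD) as [n Hn]; [auto|].
    rewrite <- Hn in KD, cD, Dx.
    exists (exterior tau (digit_union f n)); split; [split|exact Dx].
    * now exists n.
    (* The union covers [K], so its exterior misses [K]. *)
    * intros z Hz Kz; exact (exterior_disjoint _ _ _ Hz (KD z Kz)).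
Qed.
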